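(* Let $(M,d)$ be a complete pointed metric space with base point $0$. If $\phi\in\mathrm{Lip}_0(M)^*$ is normal, then $$\phi=\sum_{n\in\mathbb{Z}}\phi\circ T_{\Lambda_n}=\lim_{n\to\infty}\phi\circ T_{\Pi_n}$$ with respect to norm convergence in $\mathrm{Lip}_0(M)^*$.
   Context: $\mathrm{Lip}_0(M)$ is the Banach space of all real-valued Lipschitz functions $f$ on $M$ with $f(0)=0$, with norm $\|f\|_L=\sup\{|f(x)-f(y)|/d(x,y): x\neq y\in M\}$, and $\mathrm{Lip}_0(M)^*$ is its dual Banach space with the dual norm. Definition (normal). A functional $\phi\in\mathrm{Lip}_0(M)^*$ is normal if for every norm-bounded net $(f_i)$ in $\mathrm{Lip}_0(M)$ that converges pointwise and monotonically to some $f\in\mathrm{Lip}_0(M)$, one has $\langle f_i,\phi\rangle\to\langle f,\phi\rangle$. Equivalently, $\langle f_i,\phi\rangle\to 0$ for every net $(f_i)$ of non-negative functions in the closed unit ball of $\mathrm{Lip}_0(M)$ that decreases pointwise to $0$. For a real-valued Lipschitz function $h$ on $M$ whose support $\{x\in M:h(x)\neq 0\}$ is bounded, $T_h:\mathrm{Lip}_0(M)\to\mathrm{Lip}_0(M)$ is the bounded linear operator $T_h(f)=f\cdot h$ (pointwise product). For $n\in\mathbb{Z}$, $\Lambda_n:M\to\mathbb{R}$ is defined by $$\Lambda_n(x)=\begin{cases}0&\text{if } d(x,0)\le 2^{n-1}\\ 2^{-(n-1)}d(x,0)-1&\text{if } 2^{n-1}\le d(x,0)\le 2^n\\ 2-2^{-n}d(x,0)&\text{if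 } 2^n\le d(x,0)\le 2^{n+1}\\ 0&\text{if } 2^{n+1}\le d(x,0).\end{cases}$$ For $n\in\mathbb{N}$, $\Pi_n:M\to\mathbb{R}$ is defined by $$\Pi_n(x)=\begin{cases}0&\text{if } d(x,0)\le 2^{-(n+1)}\\ 2^{n+1}d(x,0)-1&\text{if } 2^{-(n+1)}\le d(x,0)\le 2^{-n}\\ 1&\text{if } 2^{-n}\le d(x,0)\le 2^n\\ 2-2^{-n}d(x,0)&\text{if } 2^n\le d(x,0)\le 2^{n+1}\\ 0&\text{if } 2^{n+1}\le d(x,0).\end{cases}$$ These are Lipschitz functions with bounded support, and $\Pi_n=\sum_{k=-n}^n\Lambda_k$. *)

(* Defs.v *)
From HB Require Import structures.
From mathcomp Require Import all_boot all_order all_algebra finmap.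
From mathcomp Require Import all_classical all_reals all_analysis.
From mathcomp Require Import ring lra.

Set Implicit Arguments.
Unset Strict Implicit.
Unset Printing Implicit Defensive.

Import Order.TTheory GRing.Theory Num.Theory.
Import numFieldNormedType.Exports.

Local Open Scope classical_set_scope.
Local Open Scope ring_scope.

#[short(type="completeMetricType")]
HB.structure Definition CompleteMetric (R : numDomainType) :=
  {M of Complete M & Metric R M}.

(* Continuous linear maps V -> W, a normed module under the operator norm. *)
Section ContinuousLinear.
Context {R : realType} {V W : normedModType R}.

Definition clin_pred : {pred V -> W} :=
  fun f => `[< linear f /\ continuous f >].

Record clin := Clin { clin_fun :> V -> W; _ : clin_fun \in clin_pred }.

HB.instance Definition _ := [isSub for clin_fun].
HB.instance Definition _ := [Choice of clin by <:].

Lemma clin_submod_closed : submod_closed clin_pred.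
Proof.
split.
  apply/asboolP; split; first by move=> a u v; rewrite scaler0 addr0.
  by move=> x; exact: cvg_cst.
move=> a f g /asboolP[lf cf] /asboolP[lg cg]; apply/asboolP; split.
  move=> b u v; rewrite -[LHS]/(a *: f (b *: u + v) + g (b *: u + v)).
  rewrite -[RHS]/(b *: (a *: f u + g u) + (a *: f v + g v)).
  by rewrite lf lg !scalerDr !scalerA [a * b]mulrC addrACA.
by move=> x; apply: cvgD; [apply: cvgZl_tmp; exact: cf|exact: cg].
Qed.

HB.instance Definition _ :=
  GRing.isSubmodClosed.Build R (V -> W) clin_pred clin_submod_closed.
HB.instance Definition _ := [SubChoice_isSubLmodule of clin by <:].

Lemma clin_linear (f : clin) : linear f.
Proof. by have /asboolP[] := valP f. Qed.

HB.instance Definition _ (f : clin) :=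
  GRing.isLinear.Build R V W *:%R f (clin_linear f).

Lemma clin_continuous (f : clin) : continuous f.
Proof. by have /asboolP[] := valP f. Qed.

Lemma clin_eqP (f g : clin) : f = g <-> f =1 g.
Proof. by split=> [->//|fg]; exact/val_inj/funext. Qed.

Definition clin_norm (f : clin) : R :=
  sup [set `|f x| | x in [set x : V | `|x| <= 1]].

Let nset (f : clin) := [set `|f x| | x in [set x : V | `|x| <= 1]].

Lemma clin_bounded (f : clin) : exists2 C : R, 0 < C &
  forall x, `|f x| <= C * `|x|.
Proof.
have /linear_boundedP [C [Creal Cf]] :=
  continuous_linear_bounded 0 (@clin_continuous f 0).
exists (`|C| + 1); first by rewrite ltr_wpDl.
by apply: Cf; rewrite (le_lt_trans (ler_norm _))// ltrDl.
Qed.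

Lemma clin_has_sup f : has_sup (nset f).
Proof.
split; first by exists `|f 0|, 0 => //=; rewrite normr0.
have [C C0 Cf] := clin_bounded f.
exists C => _ [x /= x1 <-]; rewrite (le_trans (Cf _))//.
by rewrite -[leRHS]mulr1 ler_wpM2l// ltW.
Qed.

Lemma clin_norm_ge0 f : 0 <= clin_norm f.
Proof.
apply: le_trans (sup_upper_bound (clin_has_sup f) _); last first.
  by exists 0 => //=; rewrite normr0.
exact: normr_ge0.
Qed.

Lemma clin_normP (f : clin) x : `|f x| <= clin_norm f * `|x|.
Proof.
have [->|x0] := eqVneq x 0; first by rewrite linear0 !normr0 mulr0.
have nx0 : 0 < `|x| by rewrite normr_gt0.
rewrite -ler_pdivrMr//.
have -> : `|f x| / `|x| = `|f (`|x|^-1 *: x)|.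
  by rewrite linearZ/= normrZ normfV normr_id mulrC.
apply: (sup_upper_bound (clin_has_sup f)); exists (`|x|^-1 *: x) => //=.
by rewrite normrZ normfV normr_id mulVf// gt_eqF.
Qed.

Lemma clin_norm_le (f : clin) C : 0 <= C ->
  (forall x, `|f x| <= C * `|x|) -> clin_norm f <= C.
Proof.
move=> C0 Cf; apply: ge_sup; first by case: (clin_has_sup f).
move=> _ [x /= x1 <-]; rewrite (le_trans (Cf _))//.
by rewrite -[leRHS]mulr1 ler_wpM2l.
Qed.

Lemma clin_normD f g : clin_norm (f + g) <= clin_norm f + clin_norm g.
Proof.
apply: clin_norm_le; first by rewrite addr_ge0 ?clin_norm_ge0.
move=> x; rewrite mulrDl (le_trans (ler_normD (f x) (g x)))//.
by rewrite lerD ?clin_normP.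
Qed.

Lemma clin_normZ a f : clin_norm (a *: f) = `|a| * clin_norm f.
Proof.
have H b g : clin_norm (b *: g) <= `|b| * clin_norm g.
  apply: clin_norm_le; first by rewrite mulr_ge0 ?clin_norm_ge0.
  move=> x; rewrite -[X in `|X|]/(b *: g x) normrZ -mulrA.
  by rewrite ler_wpM2l ?clin_normP.
apply/eqP; rewrite eq_le H/=.
have [->|a0] := eqVneq a 0; first by rewrite normr0 mul0r clin_norm_ge0.
rewrite -ler_pdivlMl ?normr_gt0// -normfV (le_trans _ (H _ _))//.
by rewrite scalerA mulVf// scale1r.
Qed.

Lemma clin_norm0_eq0 f : clin_norm f = 0 -> f = 0.
Proof.
move=> f0; apply/clin_eqP => x; apply/eqP; rewrite -normr_le0.
by rewrite (le_trans (clin_normP _ _))// f0 mul0r.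
Qed.

HB.instance Definition _ :=
  Lmodule_isNormed.Build R clin clin_normD clin_normZ clin_norm0_eq0.

End ContinuousLinear.
Arguments clin {R} V W.
Arguments clin_pred {R} V W.

Definition dual (R : realType) (V : normedModType R) := clin V R^o.

Section ClinComp.
Context {R : realType} {U V W : normedModType R}.

Lemma clin_comp_subproof (g : clin V W) (f : clin U V) :
  g \o f \in clin_pred U W.
Proof.
apply/asboolP; split; first by move=> a u v /=; rewrite !linearP.
by move=> x; apply: continuous_comp; exact: clin_continuous.
Qed.

Definition clin_comp g f := Clin (clin_comp_subproof g f).

End ClinComp.

(* lip_norm f is the least Lipschitz constant of f; over a one-point M the
   supremum is that of the empty set, which is 0. *)
Section Lip.
Context {R : realType} {M : metricType R}.

Definition lipschitz_with (k : R) (f : M -> R) :=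
  forall x y, `|f x - f y| <= k * mdist x y.

Definition is_lipschitz (f : M -> R) := exists k, lipschitz_with k f.

Definition lip_norm (f : M -> R) : R :=
  sup [set `|f p.1 - f p.2| / mdist p.1 p.2 | p in [set p : M * M | p.1 != p.2]].

Definition mbounded (A : set M) :=
  exists C : R, forall x y, A x -> A y -> mdist x y <= C.

Definition lip0_pred (x0 : M) : {pred M -> R} :=
  fun f => `[< is_lipschitz f /\ f x0 = 0 >].

Lemma is_lipschitz_ge0 (f : M -> R) : is_lipschitz f ->
  exists2 k, 0 <= k & lipschitz_with k f.
Proof.
move=> [k fk]; exists `|k| => // x y; rewrite (le_trans (fk x y))//.
by rewrite ler_wpM2r ?mdist_ge0 ?ler_norm.
Qed.

Lemma lip0_submod_closed x0 : submod_closed (lip0_pred x0).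
Proof.
split.
  by apply/asboolP; split=> //; exists 0 => x y; rewrite subrr normr0 mul0r.
move=> a f g /asboolP[/is_lipschitz_ge0[k k0 fk] f0].
move=> /asboolP[/is_lipschitz_ge0[l l0 gl] g0]; apply/asboolP; split; last first.
  by rewrite -[LHS]/(a * f x0 + g x0) f0 g0 mulr0 addr0.
exists (`|a| * k + l) => x y.
rewrite -[X in `|X|]/(a * f x + g x - (a * f y + g y)).
rewrite opprD addrACA -mulrBr (le_trans (ler_normD _ _))// normrM mulrDl.
by rewrite lerD// -mulrA ler_wpM2l.
Qed.

End Lip.

(* Lipschitz functions vanishing at the base point x0, normed by lip_norm. *)
Record lip0 (R : realType) (M : metricType R) (x0 : M) :=
  Lip0 { lip0_fun :> M -> R; _ : lip0_fun \in lip0_pred x0 }.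

Section Lip0.
Context {R : realType} {M : metricType R} (x0 : M).

HB.instance Definition _ := [isSub for @lip0_fun R M x0].
HB.instance Definition _ := [Choice of lip0 x0 by <:].
HB.instance Definition _ :=
  GRing.isSubmodClosed.Build R (M -> R) (lip0_pred x0) (lip0_submod_closed x0).
HB.instance Definition _ := [SubChoice_isSubLmodule of lip0 x0 by <:].

Lemma lip0_lipschitz (f : lip0 x0) : is_lipschitz f.
Proof. by have /asboolP[] := valP f. Qed.

Lemma lip0_base (f : lip0 x0) : f x0 = 0.
Proof. by have /asboolP[] := valP f. Qed.

Lemma lip0_eqP (f g : lip0 x0) : f = g <-> f =1 g.
Proof. by split=> [->//|fg]; exact/val_inj/funext. Qed.

Lemma lip0_normP (f : lip0 x0) : lipschitz_with (lip_norm f) f.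
Proof.
move=> x y; have [->|xy] := eqVneq x y.
  by rewrite subrr normr0 mdistxx mulr0.
rewrite -ler_pdivrMr ?mdist_gt0//; apply: sup_upper_bound; last by exists (x, y).
split; first by exists (`|f x - f y| / mdist x y), (x, y).
have [k fk] := lip0_lipschitz f; exists k => _ [[a b] /= ab <-].
by rewrite ler_pdivrMr ?mdist_gt0.
Qed.

Lemma lip0_norm_le (f : lip0 x0) k : 0 <= k ->
  lipschitz_with k f -> lip_norm f <= k.
Proof.
move=> k0 fk; rewrite /lip_norm; set A := [set _ | _ in _].
have [->|/set0P A0] := eqVneq A set0; first by rewrite sup0.
apply: ge_sup => // _ [[a b] /= ab <-].
by rewrite ler_pdivrMr ?mdist_gt0.
Qed.

Lemma lip0_norm_ge0 (f : lip0 x0) : 0 <= lip_norm f.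
Proof.
have [[a [b ab]]|ex] := pselect (exists a b : M, a != b).
  have := lip0_normP f a b; rewrite -ler_pdivrMr ?mdist_gt0//.
  by apply: le_trans; rewrite divr_ge0 ?mdist_ge0.
rewrite /lip_norm (_ : [set _ | _ in _] = set0) ?sup0//.
by rewrite -subset0 => _ [[a b] /= ab _]; apply: ex; exists a, b.
Qed.

Lemma lip0_normD (f g : lip0 x0) : lip_norm (f + g) <= lip_norm f + lip_norm g.
Proof.
apply: lip0_norm_le; first by rewrite addr_ge0 ?lip0_norm_ge0.
move=> x y; rewrite -[X in `|X|]/(f x + g x - (f y + g y)) opprD addrACA.
by rewrite (le_trans (ler_normD _ _))// mulrDl lerD ?lip0_normP.
Qed.

Lemma lip0_normZ a (f : lip0 x0) : lip_norm (a *: f) = `|a| * lip_norm f.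
Proof.
have H b (g : lip0 x0) : lip_norm (b *: g) <= `|b| * lip_norm g.
  apply: lip0_norm_le; first by rewrite mulr_ge0 ?lip0_norm_ge0.
  move=> x y; rewrite -[X in `|X|]/(b * g x - b * g y) -mulrBr normrM -mulrA.
  by rewrite ler_wpM2l ?lip0_normP.
apply/eqP; rewrite eq_le H andTb.
have [->|a0] := eqVneq a 0; first by rewrite normr0 mul0r lip0_norm_ge0.
rewrite -ler_pdivlMl ?normr_gt0// -normfV (le_trans _ (H _ _))//.
by rewrite scalerA mulVf// scale1r.
Qed.

Lemma lip0_norm0_eq0 (f : lip0 x0) : lip_norm f = 0 -> f = 0.
Proof.
move=> f0; apply/lip0_eqP => x; apply/eqP; rewrite -normr_le0.
have := lip0_normP f x x0; rewrite f0 mul0r lip0_base subr0.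
exact.
Qed.

HB.instance Definition _ := Lmodule_isNormed.Build R (lip0 x0)
  lip0_normD lip0_normZ lip0_norm0_eq0.

End Lip0.

(* Lipschitz functions with bounded support; they need not vanish at a base
   point. *)
Record lipb (R : realType) (M : metricType R) := Lipb {
  lipb_fun :> M -> R;
  lipb_lipschitz : is_lipschitz lipb_fun;
  lipb_bounded : mbounded [set x | lipb_fun x != 0] }.

(* mulop x0 h is the operator T_h : f |-> f * h on Lip_0(M). *)
Section Multiplication.
Context {R : realType} {M : metricType R} (x0 : M) (h : lipb M).

Lemma lipb_mul_bound : exists2 C, 0 <= C &
  forall f : lip0 x0, lipschitz_with (C * `|f|) (fun x => f x * h x).
Proof.
have [k k0 hk] := is_lipschitz_ge0 (lipb_lipschitz h).
have [D hD] := lipb_bounded h.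
have [h0|] := pselect (forall x, h x = 0).
  by exists 0 => // f x y; rewrite !h0 !mulr0 subrr normr0 !mul0r.
move=> /existsNP[s /eqP hs].
have D0 : 0 <= D by rewrite (le_trans _ (hD _ _ hs hs))// mdist_ge0.
pose H := `|h s| + k * D.
have H0 : 0 <= H by rewrite addr_ge0// mulr_ge0.
have hH x : `|h x| <= H.
  have [->|hx] := eqVneq (h x) 0; first by rewrite normr0.
  rewrite -[h x](subrK (h s)) (le_trans (ler_normD _ _))// addrC lerD2l.
  by rewrite (le_trans (hk _ _))// ler_wpM2l// hD.
pose K := D + mdist s x0.
have K0 : 0 <= K by rewrite addr_ge0// mdist_ge0.
have fK (f : lip0 x0) x : h x != 0 -> `|f x| <= `|f| * K.
  move=> hx; have := lip0_normP f x x0; rewrite lip0_base subr0.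
  move=> /le_trans; apply; rewrite ler_wpM2l ?lip0_norm_ge0//.
  by rewrite (le_trans (metric_triangle _ s _))// lerD2r hD.
have main (f : lip0 x0) x y : h x != 0 ->
    `|f x * h x - f y * h y| <= (K * k + H) * `|f| * mdist x y.
  move=> hx.
  have -> : f x * h x - f y * h y = f x * (h x - h y) + (f x - f y) * h y.
    by rewrite mulrBr mulrBl addrA subrK.
  rewrite (le_trans (ler_normD _ _))// !normrM.
  have -> : (K * k + H) * `|f| * mdist x y =
      (`|f| * K) * (k * mdist x y) + (`|f| * mdist x y) * H.
    by ring.
  by rewrite lerD// ler_pM// ?fK ?lip0_normP.
exists (K * k + H); first by rewrite addr_ge0// mulr_ge0.
move=> f x y; have [hx|hx] := eqVneq (h x) 0; last exact: main.
have [hy|hy] := eqVneq (h y) 0; last by rewrite distrC metric_sym main.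
rewrite hx hy !mulr0 subrr normr0 !mulr_ge0 ?mdist_ge0 ?lip0_norm_ge0//.
by rewrite addr_ge0// mulr_ge0.
Qed.

Lemma mulop_fun_subproof (f : lip0 x0) : (fun x => f x * h x) \in lip0_pred x0.
Proof.
apply/asboolP; split; last by rewrite lip0_base mul0r.
by have [C _ fC] := lipb_mul_bound; exists (C * `|f|); exact: fC.
Qed.

Definition mulop_fun (f : lip0 x0) : lip0 x0 := Lip0 (mulop_fun_subproof f).

Lemma mulop_fun_linear : linear mulop_fun.
Proof.
move=> a f g; apply/lip0_eqP => x.
rewrite -[LHS]/((a * f x + g x) * h x) -[RHS]/(a * (f x * h x) + g x * h x).
by rewrite mulrDl mulrA.
Qed.

Lemma mulop_subproof : mulop_fun \in clin_pred (lip0 x0) (lip0 x0).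
Proof.
apply/asboolP; split; first exact: mulop_fun_linear.
pose L := GRing.isLinear.Build R _ _ *:%R mulop_fun mulop_fun_linear.
pose F : {linear lip0 x0 -> lip0 x0} := HB.pack mulop_fun L.
apply: (@bounded_linear_continuous _ _ _ F); apply/linear_boundedP.
have [C C0 fC] := lipb_mul_bound.
near=> r => f; apply: (@le_trans _ _ (C * `|f|)).
  by apply: lip0_norm_le; [rewrite mulr_ge0|exact: fC].
by rewrite ler_wpM2r.
Unshelve. all: by end_near. Qed.

Definition mulop : clin (lip0 x0) (lip0 x0) := Clin mulop_subproof.

End Multiplication.

Section Cutoffs.
Context {R : realType} {M : metricType R} (x0 : M).

(* The breakpoints are assigned to the lower branch; the formulas agree there. *)
Definition Lambda_fun (n : int) (x : M) : R :=
  let r := mdist x x0 in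
  if r <= 2 ^ (n - 1) then 0
  else if r <= 2 ^ n then 2 ^ (- (n - 1)) * r - 1
  else if r <= 2 ^ (n + 1) then 2 - 2 ^ (- n) * r
  else 0.

Definition Pi_fun (n : nat) (x : M) : R :=
  let r := mdist x x0 in
  if r <= 2 ^- n.+1 then 0
  else if r <= 2 ^- n then 2 ^+ n.+1 * r - 1
  else if r <= 2 ^+ n then 1
  else if r <= 2 ^+ n.+1 then 2 - 2 ^- n * r
  else 0.

Lemma lipschitz_max (f g : M -> R) : is_lipschitz f -> is_lipschitz g ->
  is_lipschitz (fun x => Num.max (f x) (g x)).
Proof.
move=> /is_lipschitz_ge0[k k0 fk] /is_lipschitz_ge0[l l0 gl].
exists (k + l) => x y; rewrite mulrDl.
have := fk x y; have := gl x y; move: (mdist_ge0 x y).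
move: (mdist x y) (f x) (f y) (g x) (g y) => d a b c e d0 ce ab.
have kd : 0 <= k * d by rewrite mulr_ge0.
have ld : 0 <= l * d by rewrite mulr_ge0.
move: ce ab; rewrite !ler_norml => /andP[? ?] /andP[? ?].
by rewrite /Num.max; case: ifPn => ?; case: ifPn => ?; apply/andP; split; lra.
Qed.

Lemma lipschitz_dist (a b : R) : is_lipschitz (fun x : M => a * mdist x x0 + b).
Proof.
exists `|a| => x y; rewrite opprD addrACA subrr addr0 -mulrBr normrM.
rewrite ler_wpM2l// ler_norml.
have := metric_triangle x y x0; have := metric_triangle y x x0.
by rewrite [mdist y x]metric_sym => ? ?; apply/andP; split; lra.
Qed.

Lemma lipschitz_opp (f : M -> R) : is_lipschitz f ->
  is_lipschitz (fun x => - f x).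
Proof. by move=> [k fk]; exists k => x y; rewrite -opprD normrN. Qed.

Lemma lipschitz_min (f g : M -> R) : is_lipschitz f -> is_lipschitz g ->
  is_lipschitz (fun x => Num.min (f x) (g x)).
Proof.
move=> lf lg; have [k fk] :=
  lipschitz_opp (lipschitz_max (lipschitz_opp lf) (lipschitz_opp lg)).
by exists k => x y; have := fk x y; rewrite -!oppr_min !opprK.
Qed.

Lemma lipschitz_cst (a : R) : is_lipschitz (fun _ : M => a).
Proof. by exists 0 => x y; rewrite subrr normr0 mul0r. Qed.

Lemma mbounded_le (A : set M) (C : R) :
  (forall x, A x -> mdist x x0 <= C) -> mbounded A.
Proof.
move=> AC; exists (C + C) => x y /AC xC /AC yC.
by rewrite (le_trans (metric_triangle _ x0 _))// lerD// metric_sym.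
Qed.

Lemma Lambda_funE n x : Lambda_fun n x =
  Num.max 0 (Num.min (2 ^ (- (n - 1)) * mdist x x0 + - 1)
                     (- (2 ^ (- n)) * mdist x x0 + 2)).
Proof.
have two0 : (2 : R) != 0 by rewrite pnatr_eq0.
rewrite /Lambda_fun.
have -> : (2 : R) ^ (n + 1) = 2 * 2 ^ n by rewrite expfzDr// expr1z mulrC.
have -> : (2 : R) ^ (- (n - 1)) = 2 * (2 ^ n)^-1.
  by rewrite opprB expfzDr// expr1z invr_expz.
have -> : (2 : R) ^ (n - 1) = 2^-1 * 2 ^ n.
  by rewrite expfzDr// exprN1 mulrC.
rewrite -(invr_expz 2 n).
have : 0 < (2 : R) ^ n by rewrite exprz_gt0.
move: (_ ^ n) (mdist x x0) => a r a0.
have -> : (r <= a) = (r <= 1 * a) by rewrite mul1r.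
rewrite -!ler_pdivrMr// mulNr -!mulrA.
rewrite ![a^-1 * r]mulrC; move: (r / a) => b.
have [?|?] := leP (2 * b - 1) (- b + 2);
  by rewrite /Num.max; do ?[case: ifPn; rewrite -?leNgt -?ltNge => ?]; lra.
Qed.

Lemma Pi_funE n x : Pi_fun n x =
  Num.max 0 (Num.min 1 (Num.min (2 ^+ n.+1 * mdist x x0 + - 1)
                                (- (2 ^- n) * mdist x x0 + 2))).
Proof.
rewrite /Pi_fun !exprS.
have : 1 <= (2 : R) ^+ n by rewrite exprn_ege1// ler1n.
move: (_ ^+ n) (mdist x x0) (mdist_ge0 x x0) => a r r0 a1.
have a0 : 0 < a by rewrite (lt_le_trans ltr01).
have -> : (r <= (2 * a)^-1) = (a * r <= 2^-1).
  by rewrite invfM mulrC ler_pdivlMl.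
have -> : (r <= a^-1) = (a * r <= 1) by rewrite -ler_pdivlMl// mulr1.
have -> : (r <= 2 * a) = (a^-1 * r <= 2) by rewrite [a^-1 * r]mulrC ler_pdivrMr.
have -> : (r <= a) = (a^-1 * r <= 1) by rewrite [a^-1 * r]mulrC ler_pdivrMr// mul1r.
have q0 : 0 <= a^-1 * r by rewrite mulr_ge0// invr_ge0 ltW.
have qp : a^-1 * r <= a * r.
  by rewrite ler_wpM2r// (le_trans _ a1)// invf_le1.
rewrite mulNr -!mulrA; move: (a * r) (a^-1 * r) q0 qp => p q q0 qp.
have [?|?] := leP (2 * p - 1) (- q + 2).
  have [?|?] := leP 1 (2 * p - 1);
    by rewrite /Num.max; do ?[case: ifPn; rewrite -?leNgt -?ltNge => ?]; lra.
have [?|?] := leP 1 (- q + 2);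
  by rewrite /Num.max; do ?[case: ifPn; rewrite -?leNgt -?ltNge => ?]; lra.
Qed.

Lemma Lambda_lipschitz n : is_lipschitz (Lambda_fun n).
Proof.
rewrite (funext (Lambda_funE n)).
apply: lipschitz_max; first exact: lipschitz_cst.
by apply: lipschitz_min; exact: lipschitz_dist.
Qed.

Lemma Pi_lipschitz n : is_lipschitz (Pi_fun n).
Proof.
rewrite (funext (Pi_funE n)).
apply: lipschitz_max; first exact: lipschitz_cst.
apply: lipschitz_min; first exact: lipschitz_cst.
by apply: lipschitz_min; exact: lipschitz_dist.
Qed.

Lemma Lambda_bounded n : mbounded [set x | Lambda_fun n x != 0].
Proof.
apply: (@mbounded_le _ (2 ^ (n + 1))) => x /=.
rewrite /Lambda_fun; case: (leP (mdist x x0) (2 ^ (n + 1))) => // xn.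
have n2 : (2 : R) ^ n <= 2 ^ (n + 1).
  by rewrite expfzDr ?pnatr_eq0// expr1z ler_peMr ?exprz_ge0// ler1n.
have n1 : (2 : R) ^ (n - 1) <= 2 ^ n.
  by rewrite expfzDr ?pnatr_eq0// exprN1 ler_piMr ?exprz_ge0// invf_le1// ler1n.
rewrite ifN -?ltNge; last exact: le_lt_trans (le_trans n1 n2) xn.
by rewrite ifN -?ltNge ?eqxx//; exact: le_lt_trans n2 xn.
Qed.

Lemma Pi_bounded n : mbounded [set x | Pi_fun n x != 0].
Proof.
apply: (@mbounded_le _ (2 ^+ n.+1)) => x /=.
rewrite /Pi_fun; case: (leP (mdist x x0) (2 ^+ n.+1)) => // xn.
have n1 : (1 : R) <= 2 ^+ n by rewrite exprn_ege1// ler1n.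
have n2 : (2 : R) ^+ n <= 2 ^+ n.+1 by rewrite ler_eXn2l ?ltr1n.
have n3 : (2 : R) ^- n <= 2 ^+ n.+1.
  by rewrite (le_trans _ (le_trans n1 n2))// invf_le1// (lt_le_trans ltr01).
have n4 : (2 : R) ^- n.+1 <= 2 ^+ n.+1.
  rewrite (le_trans _ (le_trans n1 n2))// invf_le1 ?exprn_gt0//.
  exact: le_trans n1 n2.
by rewrite !ifN -?ltNge ?eqxx//; apply: le_lt_trans xn.
Qed.

Definition Lambda n : lipb M := Lipb (Lambda_lipschitz n) (Lambda_bounded n).

Definition Pi n : lipb M := Lipb (Pi_lipschitz n) (Pi_bounded n).

End Cutoffs.

Record directed (I : Type) (le : I -> I -> Prop) : Prop := Directed {
  directed_inhabited : inhabited I;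
  directed_refl : forall i, le i i;
  directed_trans : forall i j k, le i j -> le j k -> le i k;
  directed_ub : forall i j, exists k, le i k /\ le j k }.

(* Convergence of a net u indexed by (I, le) is u @ net_tails le --> l. *)
Definition net_tails (I : Type) (le : I -> I -> Prop) : set_system I :=
  filter_from setT (fun i => [set j | le i j]).

Definition monotone_net (R : realType) (M I : Type) (le : I -> I -> Prop)
    (u : I -> M -> R) : Prop :=
  (forall i j, le i j -> forall x, u i x <= u j x) \/
  (forall i j, le i j -> forall x, u j x <= u i x).

Definition normal (R : realType) (M : metricType R) (x0 : M)
    (phi : dual (lip0 x0)) : Prop :=
  forall (I : Type) (le : I -> I -> Prop) (u : I -> lip0 x0) (f : lip0 x0),
    directed le ->
    bounded_set (range u) ->
    monotone_net le u ->
    (forall x : M, u i x @[i --> net_tails le] --> f x) ->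
    phi (u i) @[i --> net_tails le] --> phi f.

(* Main.v *)
(* For any phi, with T_k = T_(Lambda_k), the series sum_k |phi \o T_k| converges:
   near-maximisers f_k in the unit ball give finite sums sum_k f_k Lambda_k of
   norm at most 20, because each f_k Lambda_k is 5-Lipschitz and at most two
   Lambda_k are nonzero at a given point. Normality is only used to identify
   the sum: for f >= 0 the bounded sequence f Pi_n increases to f, hence
   phi (f Pi_n) tends to phi f, with Pi_n the sum of Lambda_k over |k| <= n. *)
Require Import Defs.
From mathcomp Require Import all_boot all_order all_algebra finmap.
From mathcomp Require Import all_classical all_reals all_analysis.
From mathcomp Require Import summability.
From mathcomp Require Import ring lra zify.

Import Order.TTheory GRing.Theory Num.Theory.
Import numFieldNormedType.Exports.

Local Open Scope classical_set_scope.
Local Open Scope ring_scope.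

(** * Lipschitz bounds for finite sums of f_k Lambda_k *)

Section Cutoffs.
Context {R : realType} {M : metricType R} (x0 : M).

(** All Lambda_k are dilates of a single tent in u, so later estimates become piecewise linear case
    checks. *)
Lemma Lambda_scaleE k x (u := mdist x x0 / 2 ^ k) :
  Lambda_fun x0 k x = Num.max 0 (Num.min (2 * u - 1) (2 - u)).
Proof.
rewrite Lambda_funE.
have -> : (2 : R) ^ (- (k - 1)) = 2 * (2 ^ k)^-1.
  by rewrite opprB expfzDr ?pnatr_eq0// expr1z invr_expz.
by rewrite -(invr_expz 2 k) mulNr -mulrA [_^-1 * _]mulrC [- _ + 2]addrC.
Qed.

(** The tent has slope at most 2 in u, and u is 2^-k-Lipschitz by the triangle inequality. *)
Lemma Lambda_lipschitz_with k :
  lipschitz_with (2 * (2 ^ k)^-1) (Lambda_fun x0 k).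
Proof.
move=> x y; rewrite !Lambda_scaleE.
have a0 : 0 < ((2 : R) ^ k)^-1 by rewrite invr_gt0 exprz_gt0.
rewrite -mulrA [_^-1 * _]mulrC.
have : mdist y x0 / 2 ^ k <= mdist x y / 2 ^ k + mdist x x0 / 2 ^ k.
  by rewrite -mulrDl ler_pM2r// [mdist x y]metric_sym metric_triangle.
have : mdist x x0 / 2 ^ k <= mdist x y / 2 ^ k + mdist y x0 / 2 ^ k.
  by rewrite -mulrDl ler_pM2r// metric_triangle.
move: (_ / _) (mdist y x0 / _) (mdist x y / _) => v u w vu uv.
rewrite ler_norml; apply/andP; split;
  rewrite !minEle; do 2?[case: ifPn; rewrite -?ltNge => ?];
  rewrite !maxEle; do 2?[case: ifPn; rewrite -?ltNge => ?]; lra.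
Qed.

Lemma Lambda_ge0 k x : 0 <= Lambda_fun x0 k x.
Proof. by rewrite Lambda_funE le_max lexx. Qed.

Lemma Lambda_le1 k x : Lambda_fun x0 k x <= 1.
Proof.
rewrite Lambda_scaleE ge_max ler01 ge_min/=.
by have [u1|u1] := leP (mdist x x0 / 2 ^ k) 1; apply/orP; [left|right]; lra.
Qed.

(** Strictness matters: at distance 2^m, closed bounds would admit the three indices m - 1, m, m +
    1. *)
Lemma Lambda_neq0 k x : Lambda_fun x0 k x != 0 ->
  2 ^ (k - 1) < mdist x x0 < 2 ^ (k + 1).
Proof.
rewrite Lambda_scaleE.
have -> : (2 : R) ^ (k + 1) = 2 * 2 ^ k.
  by rewrite expfzDr ?pnatr_eq0// expr1z mulrC.
have -> : (2 : R) ^ (k - 1) = 2^-1 * 2 ^ k.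
  by rewrite expfzDr ?pnatr_eq0// exprN1 mulrC.
have a0 : 0 < (2 : R) ^ k by rewrite exprz_gt0.
rewrite -(ltr_pdivlMr _ _ a0) -(ltr_pdivrMr _ _ a0); move: (_ / _) => u.
by rewrite /Num.max minEle; case: (leP _ (2 - u)) => ?; case: ifPn => ?;
  rewrite ?eqxx// => _; apply/andP; split; lra.
Qed.

Lemma Lambda_support2 x :
  exists i, forall k, k != i -> k != i + 1 -> Lambda_fun x0 k x = 0.
Proof.
have [[k0 /Lambda_neq0/andP[k0l k0r]]|] :=
  pselect (exists k, Lambda_fun x0 k x != 0); last first.
  move=> /forallNP h; exists 0 => k _ _; apply/eqP/negPn/negP; exact: h.
have lt2 (m n : int) : (2 : R) ^ m < 2 ^ n -> m < n.
  by rewrite ltr_eXz2l// ltr1n.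
(* With r the distance to [x0], 2^(k0-1) < r <= 2^k0 leaves only k0 - 1 and k0, while 2^k0 < r <
   2^(k0+1) leaves only k0 and k0 + 1. *)
have [rk|kr] := leP (mdist x x0) (2 ^ k0).
  exists (k0 - 1) => k k1 k2; apply/eqP/negPn/negP => /Lambda_neq0/andP[kl kr].
  have := lt2 _ _ (lt_le_trans kl rk); have := lt2 _ _ (lt_trans k0l kr); lia.
exists k0 => k k1 k2; apply/eqP/negPn/negP => /Lambda_neq0/andP[kl kr'].
have := lt2 _ _ (lt_trans kl k0r); have := lt2 _ _ (lt_trans kr kr'); lia.
Qed.

(** By the product rule 5 = 4 + 1: where Lambda_k is nonzero, f is at most 2 * 2^k times its norm,
    which against the slope 2 / 2^k gives 4; the other term uses Lambda_k <= 1. *)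
Lemma mul_Lambda_lipschitz_with k (f : lip0 x0) :
  lipschitz_with (5 * `|f|) (fun x => f x * Lambda_fun x0 k x).
Proof.
have main x y : Lambda_fun x0 k x != 0 ->
    `|f x * Lambda_fun x0 k x - f y * Lambda_fun x0 k y|
      <= 5 * `|f| * mdist x y.
  move=> /Lambda_neq0/andP[_ xk].
  have -> : f x * Lambda_fun x0 k x - f y * Lambda_fun x0 k y =
      f x * (Lambda_fun x0 k x - Lambda_fun x0 k y) +
      (f x - f y) * Lambda_fun x0 k y.
    by rewrite mulrBr mulrBl addrA subrK.
  rewrite (le_trans (ler_normD _ _))// !normrM.
  have fx : `|f x| <= `|f| * (2 * 2 ^ k).
    have := lip0_normP f x x0; rewrite lip0_base subr0 => /le_trans; apply.
    rewrite ler_wpM2l ?lip0_norm_ge0// ltW//.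
    by move: xk; rewrite expfzDr ?pnatr_eq0// expr1z mulrC.
  have -> : 5 * `|f| * mdist x y =
      (`|f| * (2 * 2 ^ k)) * ((2 * (2 ^ k)^-1) * mdist x y)
      + (`|f| * mdist x y) * 1.
    have a0 : (2 : R) ^ k != 0 by rewrite expfz_neq0// pnatr_eq0.
    by field.
  rewrite lerD// ler_pM//; first exact: Lambda_lipschitz_with.
    exact: lip0_normP.
  by rewrite ger0_norm ?Lambda_ge0// Lambda_le1.
move=> x y; have [hx|hx] := eqVneq (Lambda_fun x0 k x) 0; last exact: main.
have [hy|hy] := eqVneq (Lambda_fun x0 k y) 0.
  by rewrite hx hy !mulr0 subrr normr0 mulr_ge0 ?mdist_ge0// mulr_ge0.
by rewrite distrC metric_sym main.
Qed.

Lemma sum_mul_Lambda_norm (s : seq int) (f : int -> lip0 x0) (C : R) :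
  uniq s -> 0 <= C -> (forall k, `|f k| <= C) ->
  `|\sum_(k <- s) mulop x0 (Lambda x0 k) (f k)| <= 20 * C.
Proof.
move=> us C0 fC; apply: lip0_norm_le => [|x y]; first by rewrite mulr_ge0.
have sumE z : (\sum_(k <- s) mulop x0 (Lambda x0 k) (f k)) z =
    \sum_(k <- s) f k z * Lambda_fun x0 k z.
  by elim/big_rec2: _ => // k a b _ <-.
rewrite !sumE -sumrB (le_trans (ler_norm_sum _ _ _))//.
have [i xi] := Lambda_support2 x; have [j yj] := Lambda_support2 y.
pose D := 5 * C * mdist x y.
have D0 : 0 <= D by rewrite mulr_ge0 ?mdist_ge0// mulr_ge0.
have count1 (a : int) : \sum_(k <- s) (k == a)%:R * D <= D.
  rewrite -mulr_suml -natr_sum -[leRHS]mul1r ler_wpM2r//.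
  rewrite -big_mkcond/= sum1_count -/(count_mem a s) count_uniq_mem//.
  by rewrite lern1; case: (a \in s).
(* A summand can be nonzero only at the at most four indices active at x or y, and each is at most
   [D]; coincidences among them only enlarge the majorant. Four times 5 gives 20. *)
apply: (@le_trans _ _ (\sum_(k <- s) ((k == i)%:R * D + (k == i + 1)%:R * D
    + ((k == j)%:R * D + (k == j + 1)%:R * D)))); last first.
  rewrite !big_split/= (_ : 20 * C * _ = D + D + (D + D)); last by rewrite /D; ring.
  by rewrite !lerD.
apply: ler_sum => k _; rewrite -!mulrDl.
have ub : `|f k x * Lambda_fun x0 k x - f k y * Lambda_fun x0 k y| <= D.
  rewrite (le_trans (mul_Lambda_lipschitz_with _ _ _ _))// ler_wpM2r ?mdist_ge0//.
  by rewrite ler_wpM2l.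
have [ks|] := boolP [|| k == i, k == i + 1, k == j | k == j + 1].
  apply: (le_trans ub); rewrite -[leLHS]mul1r ler_wpM2r// -!natrD ler1n.
  by move: ks; case: (k == i); case: (k == i + 1); case: (k == j);
    case: (k == j + 1).
rewrite !negb_or => /and4P[ki ki1 kj kj1].
by rewrite xi// yj// !mulr0 subrr normr0 mulr_ge0// -!natrD ler0n.
Qed.

End Cutoffs.

(** * Finite index sets exhausting the integers *)

Section Bands.

(** Recursive, so that each step adjoins exactly the two outer indices that appear in [Pi_funS]. *)
Fixpoint band (n : nat) : {fset int} :=
  if n is m.+1 then (m.+1%:Z |` (- m.+1%:Z |` band m))%fset else [fset 0]%fset.

Lemma in_band n k : (k \in band n) = (`|k| <= n)%N.
Proof.
elim: n => [|n ih] /=; first by rewrite in_fset1 leqn0 absz_eq0.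
by rewrite !in_fset1U ih; lia.
Qed.

Lemma big_band (V : zmodType) n (g : int -> V) :
  \sum_(k <- band n.+1) g k =
  g n.+1%:Z + (g (- n.+1%:Z) + \sum_(k <- band n) g k).
Proof.
rewrite /= big_fsetU1 ?big_fsetU1//= ?in_fset1U in_band; last by lia.
by lia.
Qed.

Lemma fsubset_band (F : {fset int}) n :
  (\max_(k <- F) `|k| <= n)%N -> (F `<=` band n)%fset.
Proof.
move=> Fn; apply/fsubsetP => k kF; rewrite in_band (leq_trans _ Fn)//.
exact: leq_bigmax_seq.
Qed.

Lemma big_fset_sub (V : zmodType) (F A : {fset int}) (g : int -> V) :
  (F `<=` A)%fset ->
  \sum_(k <- A) g k = \sum_(k <- F) g k + \sum_(k <- (A `\` F)%fset) g k.
Proof.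
move=> /fsubsetP FA; rewrite (big_fsetID _ (mem F))/=; congr (_ + _).
  apply: eq_fbigl => k; rewrite !inE/= andbC; case: (boolP (k \in F)) => //= kF.
  exact: FA.
by apply: eq_fbigl => k; rewrite !inE/= andbC.
Qed.

End Bands.

(** * Pi_n as a partial sum, and the limit of phi (f Pi_n) *)

Section PiSum.
Context {R : realType} {M : metricType R} (x0 : M).

(** Put p = 2^n r and q = 2^-n r, so q <= p. If p <= 1, the outer tent vanishes and the falling
    branches of both Pi are inactive; if p > 1, the inner tent vanishes and their rising branches
    are inactive. *)
Lemma Pi_funS n x : Pi_fun x0 n.+1 x =
  Lambda_fun x0 n.+1%:Z x + (Lambda_fun x0 (- n.+1%:Z) x + Pi_fun x0 n x).
Proof.
rewrite !Lambda_scaleE !Pi_funE !(mulrC (mdist x x0)).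
have -> : ((2 : R) ^ n.+1%:Z)^-1 = 2^-1 * (2 ^+ n)^-1.
  by rewrite -exprnP exprS invfM.
have -> : ((2 : R) ^ (- n.+1%:Z))^-1 = 2 * 2 ^+ n.
  by rewrite -invr_expz invrK -exprnP exprS.
rewrite !exprS ?invfM.
have : 1 <= (2 : R) ^+ n by rewrite exprn_ege1// ler1n.
move: (_ ^+ n) (mdist x x0) (mdist_ge0 x x0) => a r r0 a1.
have a0 : 0 < a by rewrite (lt_le_trans ltr01).
have q0 : 0 <= a^-1 * r by rewrite mulr_ge0// invr_ge0 ltW.
have qp : a^-1 * r <= a * r.
  by rewrite ler_wpM2r// (le_trans _ a1)// invf_le1.
rewrite !mulNr -!mulrA; move: (a * r) (a^-1 * r) q0 qp => p q q0 qp.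
have [p1|p1] := leP p 1.
  rewrite [Num.max 0 (Num.min (2 * (2^-1 * q) - 1) _)]max_l ?ge_min; last first.
    by apply/orP; left; lra.
  rewrite [Num.min (2 * p - 1) _]min_l; last by lra.
  rewrite [Num.min 1 (2 * p - 1)]min_r; last by lra.
  rewrite minA [Num.min (Num.min _ _) _]min_l ?ge_min; last first.
    by apply/orP; left; lra.
  rewrite !minEle; do 2?[case: ifPn; rewrite -?ltNge => ?; try (exfalso; lra)];
    rewrite !maxEle;
    do 3?[case: ifPn; rewrite -?ltNge => ?; try (exfalso; lra)]; lra.
rewrite [Num.max 0 (Num.min (2 * (2 * p) - 1) (2 - _))]max_l ?ge_min; last first.
  by apply/orP; right; lra.
rewrite minCA [Num.min _ (Num.min 1 _)]min_r ?ge_min; last first.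
  by apply/orP; left; lra.
rewrite [Num.min 1 (Num.min (2 * p - 1) _)]minCA.
rewrite [Num.min (2 * p - 1) _]min_r ?ge_min; last by apply/orP; left; lra.
rewrite !minEle; do 3?[case: ifPn; rewrite -?ltNge => ?; try (exfalso; lra)];
  rewrite !maxEle;
  do 3?[case: ifPn; rewrite -?ltNge => ?; try (exfalso; lra)]; lra.
Qed.

Lemma Pi_sum n x : Pi_fun x0 n x = \sum_(k <- band n) Lambda_fun x0 k x.
Proof.
elim: n => [|n ih]; last by rewrite big_band -ih Pi_funS.
rewrite big_seq_fset1 Pi_funE Lambda_scaleE expr0z expr1 expr0 invr1 mulr1.
move: (mdist _ _) => r; rewrite mulN1r [- r + 2]addrC.
(* For n = 0 the plateau shrinks to the radius r = 1, as the smaller of 2 r - 1 and 2 - r never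
   exceeds 1. *)
congr (Num.max 0 _); rewrite min_r// ge_min.
by have [r1|r1] := leP r 1; apply/orP; [left|right]; lra.
Qed.

Lemma mulop_Pi n (f : lip0 x0) :
  mulop x0 (Pi x0 n) f = \sum_(k <- band n) mulop x0 (Lambda x0 k) f.
Proof.
apply/lip0_eqP => x; rewrite -[LHS]/(f x * Pi_fun x0 n x) Pi_sum mulr_sumr.
by elim/big_rec2: _ => // k a b _ ->.
Qed.

Lemma Pi_homo x : {homo (Pi_fun x0)^~ x : m n / (m <= n)%N >-> m <= n}.
Proof.
apply: homo_leq => [//|m n p|n]; first exact: le_trans.
by rewrite Pi_funS addrA lerDr addr_ge0// Lambda_ge0.
Qed.

(** The base point is excluded because every Pi_n vanishes there; elsewhere n >= max(r, 1/r)
    suffices, by n <= 2^n. *)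
Lemma Pi_near1 x : x != x0 -> \forall n \near \oo, Pi_fun x0 n x = 1.
Proof.
move=> xx0; have r0 : 0 < mdist x x0 by rewrite mdist_gt0.
near=> n; rewrite Pi_funE.
have n2 : n%:R <= (2 : R) ^+ n.
  by rewrite -natrX ler_nat ltnW// ltn_expl.
have rn : mdist x x0 <= 2 ^+ n.
  by apply: le_trans n2; near: n; exact: nbhs_infty_ger.
have ri : (mdist x x0)^-1 <= 2 ^+ n.
  by apply: le_trans n2; near: n; exact: nbhs_infty_ger.
have : 1 <= 2 ^+ n * mdist x x0 by rewrite -ler_pdivrMr// mul1r.
have : (2 ^+ n)^-1 * mdist x x0 <= 1 by rewrite ler_pdivrMl ?mulr1// exprn_gt0.
rewrite exprS mulNr -mulrA; move: (2 ^+ n * _) (_^-1 * _) => p q q1 p1.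
rewrite [Num.min 1 _]min_l ?le_min; last by apply/andP; split; lra.
by rewrite max_r.
Unshelve. all: by end_near. Qed.

Lemma normal_cvg_Pi_ge0 (phi : dual (lip0 x0)) (f : lip0 x0) :
  normal phi -> (forall x, 0 <= f x) ->
  phi (mulop x0 (Pi x0 n) f) @[n --> \oo] --> phi f.
Proof.
move=> nphi f0.
(* Over [nat] with its order, [net_tails] unfolds to the filter [\oo], so normality applies to
   sequences. *)
apply: (nphi nat (fun m n => (m <= n)%N) (fun n => mulop x0 (Pi x0 n) f) f).
- split; [exact: inhabits 0%N|exact: leqnn|exact: (fun i j k => @leq_trans j i k)|].
  by move=> i j; exists (maxn i j); rewrite leq_maxl leq_maxr.
(* By [mulop_Pi], f Pi_n is a sum over a band, so this bound does not depend on n. *)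
- exists (20 * `|f|); split; first by rewrite num_real.
  move=> r fr _ [n _ <-]; apply: le_trans (ltW fr).
  by rewrite mulop_Pi sum_mul_Lambda_norm// fset_uniq.
- by left => m n mn x; rewrite ler_wpM2l// Pi_homo.
- move=> x; apply: (@cvg_near_cst _ _ (f x) _ \oo).
  have [->|xx0] := eqVneq x x0.
    by near=> n; rewrite !lip0_base.
  near=> n; rewrite -[LHS]/(f x * Pi_fun x0 n x) (_ : Pi_fun _ _ _ = 1) ?mulr1//.
  by near: n; exact: Pi_near1.
Unshelve. all: by end_near. Qed.

Lemma lip0_pos_subproof (f : lip0 x0) : (fun x => Num.max 0 (f x)) \in lip0_pred x0.
Proof.
apply/asboolP; split; last by rewrite lip0_base maxxx.
by apply: lipschitz_max (lip0_lipschitz f); exact: lipschitz_cst.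
Qed.

Definition lip0_pos (f : lip0 x0) : lip0 x0 := Lip0 (lip0_pos_subproof f).

(** When f changes sign, f Pi_n need not be monotone in n, hence the splitting into positive and
    negative parts. *)
Lemma normal_cvg_Pi (phi : dual (lip0 x0)) (f : lip0 x0) : normal phi ->
  phi (mulop x0 (Pi x0 n) f) @[n --> \oo] --> phi f.
Proof.
move=> nphi.
have [p [q [-> p0 q0]]] : exists p q : lip0 x0,
    [/\ f = p - q, forall x, 0 <= p x & forall x, 0 <= q x].
  exists (lip0_pos f), (lip0_pos f - f); split=> [|x|x].
  - by rewrite opprB addrC subrK.
  - by rewrite -[leRHS]/(Num.max 0 (f x)) le_max lexx.
  - by rewrite -[leRHS]/(Num.max 0 (f x) - f x) subr_ge0 le_max lexx orbT.
under eq_fun do rewrite !linearB.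
by rewrite linearB; apply: cvgB; exact: normal_cvg_Pi_ge0.
Qed.

End PiSum.

(** * Absolute summability in the dual, and the norm limits *)

Lemma partial_sumE (I : choiceType) (V : zmodType) (g : I -> V) (F : {fset I}) :
  partial_sum g F = \sum_(k <- F) g k.
Proof. by rewrite big_seq_fsetE. Qed.

Lemma clin_sumE (R : realType) (V W : normedModType R) (I : Type) (s : seq I)
    (g : I -> clin V W) (v : V) : (\sum_(k <- s) g k) v = \sum_(k <- s) g k v.
Proof. by elim/big_rec2: _ => // k a b _ <-. Qed.

Section Summability.
Context {R : realType}.

(** The factor 2 leaves room below the supremum unless the norm is 0, a separate case; passing to -
    v removes the absolute value, so that the values g v can be summed by linearity. *)
Lemma dual_norm_approx (V : normedModType R) (g : clin V R^o) :
  exists v : V, `|v| <= 1 /\ `|g| <= 2 * g v.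
Proof.
have [g0|g0] := eqVneq `|g| 0.
  by exists 0; rewrite normr0 g0 linear0 mulr0.
have gpos : `|g| / 2 < `|g| by rewrite ltr_pdivrMr// ltr_pMr ?ltr1n// lt0r g0/=.
have [_ [v /= v1 <-] gv] := sup_gt (clin_has_sup g).1 gpos.
have {}gv : `|g| <= 2 * `|g v| by rewrite mulrC -ler_pdivrMr// ltW.
have [gv0|gv0] := leP 0 (g v).
  by exists v; split=> //; rewrite -[X in _ * X]ger0_norm.
by exists (- v); rewrite normrN linearN -ltr0_norm.
Qed.

Context {M : metricType R} (x0 : M).
Implicit Types phi : dual (lip0 x0).

Let T phi k := clin_comp phi (mulop x0 (Lambda x0 k)).

(** 40 is the 2 of [dual_norm_approx] times the 20 of [sum_mul_Lambda_norm]; it does not depend on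
    [F], whence absolute summability. *)
Lemma sum_norm_Lambda phi (F : {fset int}) :
  \sum_(k <- F) `|T phi k| <= 40 * `|phi|.
Proof.
have /choice[f fP] k := dual_norm_approx _ (T phi k).
have -> : 40 * `|phi| = 2 * (`|phi| * (20 * 1)) by ring.
apply: (@le_trans _ _ (\sum_(k <- F) 2 * T phi k (f k))).
  by apply: ler_sum => k _; case: (fP k).
rewrite -mulr_sumr ler_wpM2l//.
have -> : \sum_(k <- F) T phi k (f k) =
    phi (\sum_(k <- F) mulop x0 (Lambda x0 k) (f k)) by rewrite linear_sum.
rewrite (le_trans (ler_norm _))// (le_trans (clin_normP _ _))//.
rewrite ler_wpM2l ?clin_norm_ge0//.
by apply: sum_mul_Lambda_norm => [|//|k]; [exact: fset_uniq|case: (fP k)].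
Qed.

(** Cauchy criterion: [F0] brings the nonnegative sums within e of their supremum, so a finite set
    disjoint from [F0] carries at most e. *)
Lemma tail_norm_Lambda phi e : 0 < e -> exists F0 : {fset int},
  forall F A : {fset int}, (F0 `<=` F)%fset -> (F `<=` A)%fset ->
  \sum_(k <- (A `\` F)%fset) `|T phi k| <= e.
Proof.
move=> e0; pose S := [set \sum_(k <- F) `|T phi k| | F in [set: {fset int}]].
have hS : has_sup S.
  split; first by exists (\sum_(k <- fset0) `|T phi k|), fset0.
  by exists (40 * `|phi|) => _ [F _ <-]; exact: sum_norm_Lambda.
have [_ [F0 _ <-] F0S] := sup_adherent e0 hS.
exists F0 => F A F0F FA.
have : \sum_(k <- A) `|T phi k| <= sup S by apply: sup_upper_bound => //; exists A.
rewrite (big_fset_sub _ _ _ _ FA) (big_fset_sub _ _ _ _ F0F).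
have : 0 <= \sum_(k <- (F `\` F0)%fset) `|T phi k| by exact: sumr_ge0.
lra.
Qed.

(** The tail bound is uniform in f and n, so letting n tend to infinity for each fixed f still
    yields an estimate in the dual norm. *)
Lemma normal_sum_Lambda phi : normal phi -> partial_sum (T phi) @ totally --> phi.
Proof.
move=> nphi; have tF : Filter (@totally int) by exact: totally_filter.
apply/cvgrPdist_le => e e0.
have [F0 hF0] := tail_norm_Lambda phi _ e0.
exists F0 => // F /= F0F; rewrite partial_sumE.
apply: clin_norm_le; first exact: ltW.
move=> f.
rewrite -[X in `|X|]/(phi f - (\sum_(k <- F) T phi k) f) clin_sumE.
have cv : `|phi (mulop x0 (Pi x0 n) f) - \sum_(k <- F) T phi k f|
    @[n --> \oo] --> `|phi f - \sum_(k <- F) T phi k f|.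
  by apply: cvg_norm; apply: cvgB; [exact: normal_cvg_Pi|exact: cvg_cst].
apply: (cvgr_to_le cv).
near=> n.
have FA : (F `<=` band n)%fset.
  by apply: fsubset_band; near: n; exact: nbhs_infty_ge.
(* The terms over [F] cancel, leaving the sum over [band n] minus [F], which the choice of [F0]
   controls. *)
rewrite mulop_Pi linear_sum (big_fset_sub _ _ _ _ FA) addrC addKr.
rewrite (le_trans (ler_norm_sum _ _ _))//.
apply: (@le_trans _ _ (\sum_(k <- (band n `\` F)%fset) `|T phi k| * `|f|)).
  by apply: ler_sum => k _; exact: (clin_normP (T phi k)).
by rewrite -mulr_suml ler_wpM2r// hF0.
Unshelve. all: by end_near. Qed.

(** The bands are cofinal among finite sets: [F] lies in [band n] once n bounds the absolute values
    of its elements. *)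
Lemma band_totally : band n @[n --> \oo] --> totally.
Proof.
move=> P [F _ FP]; exists (\max_(k <- F) `|k|)%N => // n /= Fn.
by apply: FP; exact: fsubset_band.
Qed.

End Summability.

Theorem lemma4 (R : realType) (M : completeMetricType R) (x0 : M)
    (phi : dual (lip0 x0)) (hphi : normal phi) :
  (partial_sum (fun n : int => clin_comp phi (mulop x0 (Lambda x0 n)))
     @ totally --> phi) /\
  (clin_comp phi (mulop x0 (Pi x0 n)) @[n --> \oo] --> phi).
Proof.
have phiL := normal_sum_Lambda x0 phi hphi.
split; first exact: phiL.
(* The Pi_n term is the partial sum over [band n], so the second limit is the first one taken along
   a cofinal sequence. *)
rewrite (_ : (fun n => _) = partial_sum
  (fun k => clin_comp phi (mulop x0 (Lambda x0 k))) \o band).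
  exact: cvg_comp band_totally phiL.
apply/funext => n; apply/clin_eqP => f.
by rewrite /= partial_sumE clin_sumE -linear_sum -mulop_Pi.
Qed.
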